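(* Let $(X,\Sigma)$ be a random pair valued in $\mathcal{X}\times\mathfrak{S}_n$, where $\mathcal{X}\subset\mathbb{R}^d$ ($d\ge1$) is equipped with a norm $\|\cdot\|$ and $X\sim\mu$. Suppose that $P_x\in\mathcal{T}$ for all $x\in\mathcal{X}$, and that there exists $M<\infty$ such that $$\sum_{i<j}|p_{i,j}(x)-p_{i,j}(x')|\le M\|x-x'\|\quad\text{for all } x,x'\in\mathcal{X}.$$ Let $\mathcal{P}$ be a finite partition of $\mathcal{X}$ into measurable cells of positive $\mu$-measure, and let $\delta_{\mathcal{P}}=\max_{\mathcal{C}\in\mathcal{P}}\sup_{(x,x')\in\mathcal{C}^2}\|x-x'\|$. (1) For every $s_{\mathcal{P}}\in\mathcal{S}^*_{\mathcal{P}}$ we have $\mathcal{R}(s_{\mathcal{P}})-\mathcal{R}^*\le M\cdot\delta_{\mathcal{P}}$. Hence, if $(\mathcal{P}_m)_{m\ge1}$ is a sequence of such partitions with $\delta_{\mathcal{P}_m}\to0$, then $\mathcal{R}(s_{\mathcal{P}_m})\to\mathcal{R}^*$ as $m\to\infty$ for any choice $s_{\mathcal{P}_m}\in\mathcal{S}^*_{\mathcal{P}_m}$. (2) Suppose in addition that $H=\inf_{x\in\mathcal{X}}\min_{i<j}|p_{i,j}(x)-1/2|>0$ and that $P_{\mathcal{C}}\in\mathcal{T}$ for all $\mathcal{C}\in\mathcal{P}$. Let $s^*_{\mathcal{P}}(x)=\sum_{\mathcal{C}\in\mathcal{P}}\sigma^*_{P_{\mathcal{C}}}\mathbb{I}\{x\in\mathcal{C}\}$.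 Then $$\mathbb{E}\big[d_\tau(\sigma^*_{P_X},s^*_{\mathcal{P}}(X))\big]\le\sup_{x\in\mathcal{X}}d_\tau(\sigma^*_{P_x},s^*_{\mathcal{P}}(x))\le (M/H)\cdot\delta_{\mathcal{P}}.$$
   Context: $\mathfrak{S}_n$ is the set of permutations of $\{1,\dots,n\}$. The Kendall $\tau$ distance is $d_\tau(\sigma,\sigma')=\sum_{i<j}\mathbb{I}\{(\sigma(i)-\sigma(j))(\sigma'(i)-\sigma'(j))<0\}$. Conditional objects: $P_x$ is the conditional distribution of $\Sigma$ given $X=x$, and $p_{i,j}(x)=\mathbb{P}\{\Sigma(i)<\Sigma(j)\mid X=x\}$. For a measurable $\mathcal{C}$ with $\mu(\mathcal{C})>0$, $P_{\mathcal{C}}$ is the conditional distribution of $\Sigma$ given $X\in\mathcal{C}$. $\mathcal{T}$ is the set of strictly stochastically transitive distributions on $\mathfrak{S}_n$. These are the $P$ with pairwise probabilities $p_{i,j}=\mathbb{P}_{\Sigma\sim P}\{\Sigma(i)<\Sigma(j)\}$ such that (a) $p_{i,j}\ge1/2$ and $p_{j,k}\ge1/2$ imply $p_{i,k}\ge1/2$, and (b) $p_{i,j}\ne1/2$ for all $i<j$. For $P\in\mathcal{T}$ the unique minimizer of $\sigma\mapsto\mathbb{E}_{\Sigma\sim P}[d_\tau(\Sigma,\sigma)]$ (Kemeny median) is denoted $\sigma^*_P$. The risk of a measurable rule $s:\mathcal{X}\to\mathfrak{S}_n$ is $\mathcal{R}(s)=\mathbb{E}[d_\tau(s(X),\Sigma)]$,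 and $\mathcal{R}^*$ is the infimum over all such rules. $\mathcal{S}_{\mathcal{P}}$ is the set of rules constant on each cell of $\mathcal{P}$. $\mathcal{S}^*_{\mathcal{P}}$ is the set of minimizers of $\mathcal{R}$ over $\mathcal{S}_{\mathcal{P}}$; equivalently, the rules whose value on each cell $\mathcal{C}$ is a Kemeny median of $P_{\mathcal{C}}$. *)

(* Defs.v *)
From HB Require Import structures.
From mathcomp Require Import all_boot all_order all_algebra all_fingroup.
From mathcomp Require Import all_classical all_reals all_analysis.
Set Implicit Arguments. Unset Strict Implicit. Unset Printing Implicit Defensive.
Import Order.TTheory GRing.Theory Num.Theory.
Local Open Scope classical_set_scope.
Local Open Scope ring_scope.

(* R^d is represented by d.-tuple R, equipped (by mathcomp-analysis)   *)
(* with the product sigma-algebra of the Borel sets of R, i.e. the     *)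
(* Borel sigma-algebra of R^d.                                         *)
Section Vectors.
Context {R : realType} {d : nat}.
Definition vzero : d.-tuple R := [tuple (0 : R) | i < d].
Definition vadd (x y : d.-tuple R) : d.-tuple R := [tuple tnth x i + tnth y i | i < d].
Definition vsub (x y : d.-tuple R) : d.-tuple R := [tuple tnth x i - tnth y i | i < d].
Definition vscale (a : R) (x : d.-tuple R) : d.-tuple R := [tuple a * tnth x i | i < d].

Definition is_norm (N : d.-tuple R -> R) : Prop :=
  [/\ forall x, 0 <= N x,
      forall x, N x = 0 -> x = vzero,
      forall a x, N (vscale a x) = `|a| * N x &
      forall x y, N (vadd x y) <= N x + N y].
End Vectors.

Section Rankings.
Context {R : realType} {n : nat}.
Notation perm := {perm 'I_n}.

Definition kendall (s s' : perm) : nat :=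
  \sum_(i < n) \sum_(j < n | (i < j)%N)
     nat_of_bool (((s i)%:Z - (s j)%:Z) * ((s' i)%:Z - (s' j)%:Z) < 0)%R.

Definition is_distr (P : {ffun perm -> R}) : Prop :=
  (forall s, 0 <= P s) /\ \sum_s P s = 1.

Definition pairp (P : {ffun perm -> R}) (i j : 'I_n) : R :=
  \sum_(s : perm | (s i < s j)%N) P s.

Definition strictly_transitive (P : {ffun perm -> R}) : Prop :=
  [/\ is_distr P,
      (forall i j k : 'I_n, i != j -> j != k -> i != k ->
         1/2 <= pairp P i j -> 1/2 <= pairp P j k -> 1/2 <= pairp P i k) &
      (forall i j : 'I_n, (i < j)%N -> pairp P i j != 1/2)].

Definition kemeny_loss (P : {ffun perm -> R}) (s : perm) : R :=
  \sum_(t : perm) P t * (kendall t s)%:R.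

Definition is_kemeny_median (P : {ffun perm -> R}) (s : perm) : Prop :=
  forall s', kemeny_loss P s <= kemeny_loss P s'.

(* sigma^*_P : a (for P in T, the unique) minimizer of the Kemeny loss *)
Definition kemeny_median (P : {ffun perm -> R}) : perm :=
  xget (1%g : perm) [set s | is_kemeny_median P s].
End Rankings.

Section Model.
Context {R : realType} {d n : nat}.
Notation T := (d.-tuple R).
Notation perm := {perm 'I_n}.
Variable mu : probability T R.
Variable Pk : T -> {ffun perm -> R}.      (* x |-> P_x, law of Sigma given X = x *)
Variable Xs : set T.

Definition cond_distr (C : set T) : {ffun perm -> R} :=
  [ffun s => fine (\int[mu]_(x in C) (Pk x s)%:E) / fine (mu C)].

(* measurable rules s : X -> S_n (S_n with its discrete sigma-algebra) *)
Definition measurable_rule (s : T -> perm) : Prop :=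
  forall t : perm, measurable (Xs `&` s @^-1` [set t]).

(* R(s) = E[d_tau(s(X), Sigma)] *)
Definition risk (s : T -> perm) : \bar R :=
  (\int[mu]_(x in Xs) (\sum_(t : perm) Pk x t * (kendall (s x) t)%:R)%:E)%E.

Definition opt_risk : \bar R :=
  ereal_inf [set risk s | s in [set s | measurable_rule s]].

Definition is_partition (k : nat) (C : 'I_k -> set T) : Prop :=
  [/\ forall i, measurable (C i),
      forall i, (0 < mu (C i))%E,
      forall i j, i != j -> C i `&` C j = set0 &
      \bigcup_(i in [set: 'I_k]) C i = Xs].

Definition piecewise_const (k : nat) (C : 'I_k -> set T) (s : T -> perm) : Prop :=
  forall i x y, C i x -> C i y -> s x = s y.

Definition optimal_piecewise (k : nat) (C : 'I_k -> set T) (s : T -> perm) : Prop :=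
  piecewise_const C s /\
  forall s', piecewise_const C s' -> (risk s <= risk s')%E.

Definition diam (N : T -> R) (C : set T) : \bar R :=
  ereal_sup [set (N (vsub x y))%:E | x in C & y in C].

Definition mesh (N : T -> R) (k : nat) (C : 'I_k -> set T) : \bar R :=
  \big[Order.max/-oo%E]_(i < k) diam N (C i).

Definition margin : \bar R :=
  ereal_inf [set (\big[Order.min/+oo%E]_(i < n) \big[Order.min/+oo%E]_(j < n | (i < j)%N)
                    (`|pairp (Pk x) i j - 1/2|)%:E) | x in Xs].
End Model.

(* Main.v *)
(* Write L_P for the Kemeny loss of P, C for a cell and D = M * mesh.  Since
   L_P(s) is a sum over pairs i < j of either p_ij or 1 - p_ij, it is
   1-Lipschitz in (p_ij), and P_C is the mu-average of the P_x over C.  If m is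
   a median of P_C and s is any rule, then for x in C
     L_{P_C}(m) <= L_{P_C}(s x) <= L_{P_x}(s x) + D,
   and the left side integrates over C to exactly the risk of m on C; this is
   why (1) holds with constant 1 rather than 2.
   For (2), the median of P in T ranks i before j iff p_ij > 1/2, so for a pair
   on which the medians of P_x and P_C disagree, 1/2 separates p_ij(x) from
   p_ij(C), whence |p_ij(x) - p_ij(C)| >= |p_ij(x) - 1/2| >= H. *)
Require Import Defs.
From HB Require Import structures.
From mathcomp Require Import all_boot all_order all_algebra all_fingroup.
From mathcomp Require Import all_classical all_reals all_analysis.
From mathcomp Require Import measurable_realfun lra.
Import Order.TTheory GRing.Theory Num.Theory.
Local Open Scope classical_set_scope.
Local Open Scope ring_scope.

(** * Kendall distance, pairwise probabilities and Kemeny medians of one distribution *)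

Section Kemeny.
Set Implicit Arguments.
Unset Strict Implicit.
Context {R : realType} {n : nat}.
Implicit Types (P Q : {ffun {perm 'I_n} -> R}) (s t : {perm 'I_n}) (i j : 'I_n).

Lemma perm_ltnC s i j : i != j -> (s j < s i)%N = ~~ (s i < s j)%N.
Proof.
move=> nij; rewrite -leqNgt ltn_neqAle andb_idl// => _.
by rewrite val_eqE (inj_eq perm_inj) eq_sym.
Qed.

(** Distinct items have distinct ranks, so neither factor vanishes and only the two signs matter. *)
Lemma discordantE s t i j : i != j ->
  (((s i)%:Z - (s j)%:Z) * ((t i)%:Z - (t j)%:Z) < 0) =
  ((s i < s j)%N != (t i < t j)%N).
Proof.
move=> nij; have sub_lt0 (u : {perm 'I_n}) :
    ((u i)%:Z - (u j)%:Z < 0) = (u i < u j)%N by rewrite subr_lt0 ltz_nat.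
have sub_gt0 (u : {perm 'I_n}) : (0 < (u i)%:Z - (u j)%:Z) = ~~ (u i < u j)%N.
  by rewrite subr_gt0 ltz_nat perm_ltnC.
case: (boolP (s i < s j)%N) => sij.
  by rewrite nmulr_rlt0 ?sub_lt0// sub_gt0.
by rewrite pmulr_rlt0 ?sub_gt0// sub_lt0; case: (t i < t j)%N.
Qed.

Lemma kendallE s t : kendall s t =
  (\sum_(i < n) \sum_(j < n | i < j) ((s i < s j) != (t i < t j)))%N.
Proof.
apply: eq_bigr => i _; apply: eq_bigr => j ij.
by rewrite discordantE// neq_ltn ij.
Qed.

Lemma kendallC s t : kendall s t = kendall t s.
Proof.
rewrite !kendallE; apply: eq_bigr => i _; apply: eq_bigr => j _.
by rewrite eq_sym.
Qed.

Lemma pairpE P i j :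
  pairp P i j = \sum_(t : {perm 'I_n}) P t * ((t i < t j)%N)%:R.
Proof.
rewrite /pairp big_mkcond; apply: eq_bigr => t _.
by case: (t i < t j)%N; rewrite ?mulr1 ?mulr0.
Qed.

Lemma pairpC P i j : is_distr P -> i != j -> pairp P j i = 1 - pairp P i j.
Proof.
move=> [_ P1] nij; rewrite -P1 (bigID (fun t : {perm 'I_n} => (t i < t j)%N))/=.
rewrite addrAC subrr add0r; apply: eq_bigl => t; exact: perm_ltnC.
Qed.

(** This brings a combination of pairwise probabilities to the form [\sum_t P t * w t], the one that
    averages over a cell. *)
Lemma pairp_combination P (e : 'I_n -> 'I_n -> R) :
  \sum_(i < n) \sum_(j < n | (i < j)%N) e i j * pairp P i j =
  \sum_t P t * \sum_(i < n) \sum_(j < n | (i < j)%N) e i j * ((t i < t j)%N)%:R.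
Proof.
under [RHS]eq_bigr do rewrite mulr_sumr.
rewrite exchange_big; apply: eq_bigr => i _.
under [RHS]eq_bigr do rewrite mulr_sumr.
rewrite exchange_big; apply: eq_bigr => j _.
by rewrite pairpE mulr_sumr; apply: eq_bigr => t _; rewrite mulrCA.
Qed.

(** For a distribution [P] and [i != j], this is the probability that a ranking drawn from [P]
    orders the pair against [s]. *)
Definition pair_loss P s i j : R :=
  if (s i < s j)%N then 1 - pairp P i j else pairp P i j.

Lemma kemeny_lossE P s : is_distr P -> kemeny_loss P s =
  \sum_(i < n) \sum_(j < n | (i < j)%N) pair_loss P s i j.
Proof.
move=> dP; rewrite /kemeny_loss.
under eq_bigr do rewrite kendallE natr_sum mulr_sumr.
rewrite exchange_big; apply: eq_bigr => i _.
under eq_bigr do rewrite natr_sum mulr_sumr.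
rewrite exchange_big; apply: eq_bigr => j ij; rewrite /pair_loss.
have nij : i != j by rewrite neq_ltn ij.
case: ifPn => sij; last first.
  by rewrite pairpE; apply: eq_bigr => t _; rewrite eqbF_neg negbK.
rewrite -(pairpC dP nij) pairpE; apply: eq_bigr => t _.
by rewrite (perm_ltnC _ nij); case: (t i < t j)%N.
Qed.

Lemma kemeny_loss_lipschitz P Q s : is_distr P -> is_distr Q ->
  kemeny_loss P s <= kemeny_loss Q s +
    \sum_(i < n) \sum_(j < n | (i < j)%N) `|pairp P i j - pairp Q i j|.
Proof.
move=> dP dQ; rewrite !kemeny_lossE// -big_split ler_sum// => i _ /=.
rewrite -big_split ler_sum// => j _ /=; rewrite /pair_loss.
have := ler_norm (pairp P i j - pairp Q i j).
have := ler_norm (pairp Q i j - pairp P i j); rewrite distrC.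
by case: ifP => _; lra.
Qed.

Lemma kemeny_loss_ge0 P s : is_distr P -> 0 <= kemeny_loss P s.
Proof. by move=> [P0 _]; apply: sumr_ge0 => t _; rewrite mulr_ge0. Qed.

Lemma kemeny_medianP P : is_kemeny_median P (kemeny_median P).
Proof.
apply: (@xgetPex _ 1%g [set s | is_kemeny_median P s]).
exists [arg min_(s < 1%g) kemeny_loss P s]%O => s /=.
by case: arg_minP => // s0 _; exact.
Qed.

Lemma strictly_transitive_neq P i j :
  strictly_transitive P -> i != j -> pairp P i j != 1/2.
Proof.
move=> [dP _ neP]; rewrite neq_ltn => /orP[|ji]; first exact: neP.
have := neP _ _ ji; apply: contraNN => /eqP pij.
by rewrite pairpC ?pij ?neq_ltn ?ji ?orbT//; apply/eqP; lra.
Qed.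

(** Such a ranking minimizes the loss of every pair at once, which makes it the benchmark that
    identifies the median. *)
Lemma transitive_ranking P : strictly_transitive P ->
  exists s, forall i j, (i < j)%N -> (s i < s j)%N = (1/2 < pairp P i j).
Proof.
move=> TP; have [dP trP _] := TP.
(* By transitivity, each item's number of strict predecessors is its rank. *)
pose beaten i := [set k | (k != i) && (1/2 < pairp P k i)]%SET.
have beatenP i : (#|beaten i| < n)%N.
  rewrite -[ltnRHS]card_ord; apply: proper_card; apply/properP; split.
    exact: subset_predT.
  by exists i => //; rewrite !inE eqxx.
(* Transitivity includes [beaten i] in [beaten j], and [i] itself makes the inclusion strict. *)
have mono i j : i != j -> 1/2 < pairp P i j -> (#|beaten i| < #|beaten j|)%N.
  move=> ij pij; apply: proper_card; apply/properP; split; last first.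
    by exists i; rewrite !inE ?ij// eqxx.
  apply/fintype.subsetP => k; rewrite !inE => /andP[ki pki].
  have kj : k != j.
    apply: contraTneq pij => <-.
    by rewrite (pairpC dP ki) -leNgt; lra.
  rewrite kj lt_neqAle eq_sym strictly_transitive_neq//=.
  by apply: (trP k i j) => //; exact: ltW.
have tot i j : i != j -> ~~ (1/2 < pairp P i j) -> 1/2 < pairp P j i.
  move=> ij; rewrite -leNgt (pairpC dP ij) => pij.
  by have := strictly_transitive_neq TP ij; rewrite neq_lt; lra.
(* Two distinct items compare strictly one way or the other, so by [mono] their counts differ. *)
have inj : injective (fun i => Ordinal (beatenP i)).
  move=> i j /(congr1 val)/= eij; apply/eqP; apply/negPn/negP => ij.
  have [/(mono _ _ ij)|/(tot _ _ ij)/mono] := boolP (1/2 < pairp P i j).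
    by rewrite eij ltnn.
  by rewrite eq_sym eij ltnn => /(_ ij).
exists (perm inj) => i j ij; rewrite !permE/=.
have nij : i != j by rewrite neq_ltn ij.
have [/(mono _ _ nij)//|pij] := boolP (1/2 < pairp P i j).
apply/negbTE; rewrite -leqNgt ltnW// mono//; first by rewrite eq_sym.
exact: tot.
Qed.

(** The median loses nothing overall against the ranking of [transitive_ranking], which is optimal
    on each pair. The gaps are nonnegative with a nonpositive sum, so all vanish; since no
    probability is 1/2, a zero gap fixes the order of the pair. *)
Lemma kemeny_median_ltE P i j : strictly_transitive P -> (i < j)%N ->
  (kemeny_median P i < kemeny_median P j)%N = (1/2 < pairp P i j).
Proof.
move=> TP ij; have [dP _ _] := TP; have [s sE] := transitive_ranking TP.
set m := kemeny_median P.
have s_min (k l : 'I_n) : (k < l)%N -> 0 <= pair_loss P m k l - pair_loss P s k l.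
  move=> kl; rewrite /pair_loss sE//.
  by case: (ltrP (1/2) (pairp P k l)); case: (m k < m l)%N; lra.
have : \sum_(k < n) \sum_(l < n | (k < l)%N)
    (pair_loss P m k l - pair_loss P s k l) = 0.
  apply/eqP; rewrite eq_le; apply/andP; split; last first.
    by apply: sumr_ge0 => k _; apply: sumr_ge0 => l; exact: s_min.
  under eq_bigr do rewrite sumrB.
  by rewrite sumrB -!kemeny_lossE// subr_le0; exact: kemeny_medianP.
move=> /psumr_eq0P => /(_ (fun k _ => sumr_ge0 _ (s_min k)))/(_ i isT).
move=> /psumr_eq0P => /(_ (s_min i))/(_ j ij).
have := strictly_transitive_neq TP (negbT (ltn_eqF ij)); rewrite neq_lt.
rewrite /pair_loss sE//.
by case: (ltrP (1/2) (pairp P i j)); case: (m i < m j)%N => //=; lra.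
Qed.

Lemma kendall_median_le P Q (h : R) :
  strictly_transitive P -> strictly_transitive Q ->
  (forall i j, (i < j)%N -> h <= `|pairp P i j - 1/2|) ->
  h * (kendall (kemeny_median P) (kemeny_median Q))%:R <=
    \sum_(i < n) \sum_(j < n | (i < j)%N) `|pairp P i j - pairp Q i j|.
Proof.
move=> TP TQ hP; rewrite kendallE natr_sum mulr_sumr ler_sum// => i _.
rewrite natr_sum mulr_sumr ler_sum// => j ij.
rewrite !kemeny_median_ltE//; have := hP i j ij.
have := ler_norm (pairp P i j - pairp Q i j).
have := ler_norm (pairp Q i j - pairp P i j); rewrite [`|pairp Q _ _ - _|]distrC.
case: (ltrP (1/2)) => [p|p]; case: (ltrP (1/2)) => q /=;
  rewrite ?mulr0 ?mulr1 ?normr_ge0//.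
- by rewrite gtr0_norm; lra.
- by rewrite ler0_norm; lra.
Qed.
End Kemeny.

(** * Rankings depending on a covariate, and the risk of a rule *)

Section Regression.
Set Implicit Arguments.
Unset Strict Implicit.
Context {R : realType} {d n : nat} (mu : probability (d.-tuple R) R).
Context (Pk : d.-tuple R -> {ffun {perm 'I_n} -> R}) (Xs : set (d.-tuple R)).
Hypothesis mXs : measurable Xs.
Hypothesis muXs : mu Xs = 1%E.
Hypothesis mPk : forall t, measurable_fun Xs (fun x => Pk x t).
Hypothesis dPk : forall x, Xs x -> is_distr (Pk x).
Implicit Types (s : d.-tuple R -> {perm 'I_n}).

(** The integral of a nonnegative function is a supremum over the simple functions below it, and a
    larger function has more of them. This serves for the distance to the median of [Pk x], whose
    measurability in [x] is not established. *)
Lemma ge0_le_integral_nonmeasurable (D : set (d.-tuple R))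
    (f g : d.-tuple R -> \bar R) :
  (forall x, D x -> 0 <= f x)%E -> (forall x, D x -> f x <= g x)%E ->
  (\int[mu]_(x in D) f x <= \int[mu]_(x in D) g x)%E.
Proof.
move=> f0 fg; have g0 x : D x -> (0 <= g x)%E.
  by move=> Dx; exact: le_trans (f0 x Dx) (fg x Dx).
rewrite !ge0_integralE//; apply: ge_ereal_sup => _ [h /= hf <-].
apply: ereal_sup_ubound; exists h => //= x; apply: le_trans (hf x) _.
exact: lee_restrict.
Qed.

(** * Averaging the conditional laws over one cell *)

Section Cell.
Context (C : set (d.-tuple R)).
Hypothesis mC : measurable C.
Hypothesis CXs : C `<=` Xs.
Hypothesis muC : (0 < mu C)%E.

Lemma cell_integrable t : mu.-integrable C (EFin \o (fun x => Pk x t)).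
Proof.
apply: measurable_bounded_integrable => //.
- by rewrite (le_lt_trans (probability_le1 mu mC))// ltry.
- exact: measurable_funS (mPk t).
exists 1; split => // r r1 x Cx /=; have [P0 P1] := dPk (CXs Cx).
rewrite ger0_norm// (le_trans _ (ltW r1))// -P1 (bigD1 t)//= lerDl.
exact: sumr_ge0.
Qed.

Lemma cell_measure_gt0 : 0 < fine (mu C).
Proof. by apply: fine_gt0; rewrite muC (le_lt_trans (probability_le1 mu mC))// ltry. Qed.

(** Linearity of the integral. The weight is left general to cover both Kendall losses and signed
    combinations of pairwise probabilities. *)
Lemma integral_cond_distr (w : {perm 'I_n} -> R) :
  (\int[mu]_(x in C) (\sum_t Pk x t * w t)%:E =
   ((\sum_t cond_distr mu Pk C t * w t) * fine (mu C))%:E)%E.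
Proof.
under eq_integral do rewrite -sumEFin.
rewrite integral_sum//; last first.
  by move=> t; have := integrableZr mC (w t) (cell_integrable t).
rewrite mulr_suml -sumEFin; apply: eq_bigr => t _; rewrite ffunE.
under eq_integral do rewrite EFinM.
rewrite (integralZr mC (cell_integrable t)).
rewrite mulrAC divfK ?gt_eqF ?cell_measure_gt0// EFinM fineK//.
exact: integrable_fin_num (cell_integrable t).
Qed.

Lemma le_cond_distr (w : {perm 'I_n} -> R) (c : R) :
  (forall x, C x -> c <= \sum_t Pk x t * w t) ->
  c <= \sum_t cond_distr mu Pk C t * w t.
Proof.
move=> cw; rewrite -(ler_pM2r cell_measure_gt0) -lee_fin -integral_cond_distr.
rewrite EFinM fineK ?fin_num_measure//.
rewrite -(integral_cst mu mC) le_integral//.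
- exact: (finite_measure_integrable_cst mu c mC).
- under eq_fun do rewrite -sumEFin.
  apply: (integrable_sum mC) => t _.
  by have := integrableZr mC (w t) (cell_integrable t).
- by move=> x; rewrite inE lee_fin; exact: cw.
Qed.

Lemma cond_distr_le (w : {perm 'I_n} -> R) (c : R) :
  (forall x, C x -> \sum_t Pk x t * w t <= c) ->
  \sum_t cond_distr mu Pk C t * w t <= c.
Proof.
move=> wc; rewrite -lerN2 -sumrN.
under eq_bigr do rewrite -mulrN.
apply: le_cond_distr => x /wc; rewrite -lerN2 -sumrN.
by under eq_bigr do rewrite -mulrN.
Qed.

End Cell.

Lemma measurable_kemeny_loss s : measurable_rule Xs s ->
  measurable_fun Xs (fun x => kemeny_loss (Pk x) (s x)).
Proof.
move=> ms _ B mB.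
have mloss t : measurable_fun Xs (fun x => kemeny_loss (Pk x) t).
  apply: measurable_sum => u.
  exact: measurable_funM.
(* Split by the finitely many values of [s]: on each piece the loss is that of a fixed
   permutation. *)
rewrite (_ : _ `&` _ = \bigcup_(t in [set: {perm 'I_n}])
    ((Xs `&` s @^-1` [set t]) `&`
     (Xs `&` (fun x => kemeny_loss (Pk x) t) @^-1` B))).
  apply: fin_bigcup_measurable => [|t _]; first exact: finite_finset.
  by apply: measurableI; [exact: ms|exact: mloss].
apply/seteqP; split => [x [Xx Bx]|x [t _ [[Xx /= <-] [_ Bx]]]]//.
by exists (s x).
Qed.

Lemma riskE s : risk mu Pk Xs s =
  (\int[mu]_(x in Xs) (kemeny_loss (Pk x) (s x))%:E)%E.
Proof.
apply: eq_integral => x _; congr EFin; apply: eq_bigr => t _.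
by rewrite kendallC.
Qed.

Lemma risk_ge0 s : (0 <= risk mu Pk Xs s)%E.
Proof.
rewrite riskE; apply: integral_ge0 => x Xx; rewrite lee_fin.
exact: kemeny_loss_ge0 (dPk Xx).
Qed.

(** Losses are nonnegative, and a constant rule has finite risk. Finiteness allows the optimal risk
    to be moved across inequalities in [\bar R]. *)
Lemma opt_risk_fin_num : opt_risk mu Pk Xs \is a fin_num.
Proof.
have mcst : measurable_rule Xs (fun=> 1%g : {perm 'I_n}).
  move=> t; have [->|/eqP t1] := eqVneq t 1%g.
    by rewrite (_ : _ @^-1` _ = setT) ?setIT//; apply/seteqP; split.
  by rewrite (_ : _ @^-1` _ = set0) ?setI0//; apply/seteqP; split => // x /= /esym.
rewrite ge0_fin_numE; last first.
  by apply: le_ereal_inf_tmp => _ [s _ <-]; exact: risk_ge0.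
apply: (@le_lt_trans _ _ (risk mu Pk Xs (fun=> 1%g))).
  by apply: ereal_inf_lbound; exists (fun=> 1%g).
rewrite /risk integral_cond_distr// ?ltry// muXs//.
Qed.

(** * Rules attached to a finite partition *)

Section Partition.
Context (k : nat) (C : 'I_k -> set (d.-tuple R)).
Hypothesis partC : is_partition mu Xs C.

Let mC i : measurable (C i). Proof. by case: partC. Qed.
Let muC i : (0 < mu (C i))%E. Proof. by case: partC. Qed.

Lemma cell_subset i : C i `<=` Xs.
Proof. by case: partC => _ _ _ <- x Cx; exists i. Qed.

Lemma cell_exists x : Xs x -> exists i, C i x.
Proof. by case: partC => _ _ _ <- [i _]; exists i. Qed.

Lemma cell_unique i j x : C i x -> C j x -> i = j.
Proof.
case: partC => _ _ disj _ Cix Cjx; apply: contrapT => /eqP/disj.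
by move=> /seteqP[/(_ x) + _]; apply.
Qed.

Lemma partition_nonempty : exists x, Xs x.
Proof.
apply: contrapT => /forallNP X0; have := muXs.
suff -> : Xs = set0 by rewrite measure0 => /eqP; rewrite eqe eq_sym oner_eq0.
by apply/seteqP; split.
Qed.

Lemma ge0_integral_cells (f : d.-tuple R -> \bar R) :
  measurable_fun Xs f -> (forall x, Xs x -> 0 <= f x)%E ->
  (\int[mu]_(x in Xs) f x = \sum_(i < k) \int[mu]_(x in C i) f x)%E.
Proof.
have XsE : Xs = \big[setU/set0]_(i < k) C i.
  case: partC => _ _ _ <-; rewrite -bigcup_seq.
  apply/seteqP; split => x [i _ Cx]; exists i => //=.
  exact: mem_index_enum.
rewrite XsE => mf f0; rewrite ge0_integral_bigsetU//.
  exact: index_enum_uniq.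
move=> i j _ _ [x [Cix Cjx]]; exact: cell_unique Cix Cjx.
Qed.

Lemma piecewise_const_measurable s : piecewise_const C s -> measurable_rule Xs s.
Proof.
move=> sC t; rewrite (_ : _ `&` _ =
    \bigcup_(i in [set i | exists2 x, C i x & s x = t]) C i).
  by apply: fin_bigcup_measurable => //; exact: finite_finset.
apply/seteqP; split => [x [/cell_exists[i Cx] sx]|x [i [y Cy sy] Cx]].
  by exists i => //; exists x.
by split; [exact: cell_subset Cx|rewrite /= -sy; exact: sC Cx Cy].
Qed.

(** A competitor among piecewise constant rules: a risk minimizer does at least as well, so it
    suffices to bound the risk of this one. The identity is a default value off the cells. *)
Definition median_rule x : {perm 'I_n} :=
  if [pick i | x \in C i] is Some i then kemeny_median (cond_distr mu Pk (C i))
  else 1%g.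

Lemma median_ruleE i x : C i x ->
  median_rule x = kemeny_median (cond_distr mu Pk (C i)).
Proof.
move=> Cx; rewrite /median_rule; case: pickP => [j|/(_ i)].
  by rewrite inE => /(cell_unique Cx) ->.
by rewrite mem_set.
Qed.

Lemma median_rule_piecewise_const : piecewise_const C median_rule.
Proof. by move=> i x y Cx Cy; rewrite !(@median_ruleE i). Qed.

(** * Excess risk when the pairwise probabilities vary by at most [D] within each cell *)

Section Variation.
Context (D : R).
Hypothesis D0 : 0 <= D.
Hypothesis variation_le : forall i x x', C i x -> C i x' ->
  \sum_(i < n) \sum_(j < n | (i < j)%N) `|pairp (Pk x) i j - pairp (Pk x') i j|
    <= D.

Lemma variation_cond_distr_le i x : C i x ->
  \sum_(a < n) \sum_(b < n | (a < b)%N)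
    `|pairp (Pk x) a b - pairp (cond_distr mu Pk (C i)) a b| <= D.
Proof.
move=> Cx; set Q := cond_distr mu Pk (C i).
(* The signs make the sum of absolute values linear in Q, hence an average over the cell. *)
pose e a b := Num.sg (pairp (Pk x) a b - pairp Q a b).
have splitE (P P' : {ffun {perm 'I_n} -> R}) :
    \sum_(a < n) \sum_(b < n | (a < b)%N) e a b * (pairp P a b - pairp P' a b) =
    \sum_(a < n) \sum_(b < n | (a < b)%N) e a b * pairp P a b -
    \sum_(a < n) \sum_(b < n | (a < b)%N) e a b * pairp P' a b.
  rewrite -sumrB; apply: eq_bigr => a _; rewrite -sumrB.
  by apply: eq_bigr => b _; rewrite mulrBr.
under eq_bigr do under eq_bigr do rewrite normrEsg.
rewrite splitE lerBlDr -lerBlDl [leRHS]pairp_combination.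
apply: le_cond_distr => //; first exact: cell_subset.
move=> x' Cx'; rewrite -[leRHS]pairp_combination lerBlDl -lerBlDr -splitE.
apply: le_trans (variation_le Cx Cx').
rewrite ler_sum// => a _; rewrite ler_sum// => b _.
apply: le_trans (ler_norm _) _; rewrite normrM normr_sg.
by case: (_ != 0); rewrite ?mul1r ?mul0r.
Qed.

Lemma risk_median_rule_le s : measurable_rule Xs s ->
  (risk mu Pk Xs median_rule <= risk mu Pk Xs s + D%:E)%E.
Proof.
move=> ms; have mm := piecewise_const_measurable median_rule_piecewise_const.
have mloss s' : measurable_rule Xs s' ->
    measurable_fun Xs (fun x => (kemeny_loss (Pk x) (s' x))%:E).
  by move=> ms'; apply/measurable_EFinP; exact: measurable_kemeny_loss.
have loss_ge0 (t : {perm 'I_n}) x : Xs x -> (0 <= (kemeny_loss (Pk x) t)%:E)%E.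
  by move=> Xx; rewrite lee_fin kemeny_loss_ge0//; exact: dPk.
(* As [Xs] has mass 1, [D] can be put under the integral, and the two risks are then compared cell
   by cell. *)
have -> : (risk mu Pk Xs s + D%:E =
    \int[mu]_(x in Xs) ((kemeny_loss (Pk x) (s x))%:E + D%:E))%E.
  rewrite ge0_integralD//; last 2 first.
  - by move=> x Xx; exact: loss_ge0.
  - exact: mloss.
  rewrite (integral_cst mu mXs D%:E) [X in (_ * X)%E](_ : _ = 1%E)//.
  by rewrite mule1 riskE.
have mf : measurable_fun Xs (fun x => ((kemeny_loss (Pk x) (s x))%:E + D%:E)%E).
  apply: emeasurable_funD => //.
  exact: mloss.
rewrite riskE !ge0_integral_cells//; first last.
- by move=> x Xx; exact: loss_ge0.
- exact: mloss.
- by move=> x Xx; rewrite adde_ge0// loss_ge0.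
apply: lee_sum => i _; set m := kemeny_median (cond_distr mu Pk (C i)).
rewrite (eq_integral (fun x => (kemeny_loss (Pk x) m)%:E)); last first.
  by move=> x; rewrite inE => Cx; rewrite (median_ruleE Cx).
(* On the cell, the risk of [m] is its loss under the averaged law times the mass, that is, the
   integral of a constant; a pointwise bound is now enough. *)
rewrite (integral_cond_distr (mC i) (@cell_subset i) (muC i)).
rewrite EFinM fineK ?fin_num_measure// -(integral_cst mu (mC i)).
have m_ge0 : 0 <= \sum_t cond_distr mu Pk (C i) t * (kendall t m)%:R.
  apply: le_cond_distr => // [|x Cx]; first exact: cell_subset.
  by rewrite kemeny_loss_ge0//; exact/dPk/cell_subset/Cx.
apply: ge0_le_integral_nonmeasurable => x Cx; first by rewrite lee_fin.
(* With [x] fixed, [s x] is one permutation against which [m] is optimal; its averaged loss is then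
   bounded through each [x'] of the cell. *)
rewrite /= -EFinD lee_fin; apply: le_trans (kemeny_medianP _ (s x)) _.
apply: cond_distr_le => // [|x' Cx']; first exact: cell_subset.
apply: le_trans (kemeny_loss_lipschitz _ (dPk (cell_subset Cx')) (dPk (cell_subset Cx))) _.
by rewrite lerD2l; exact: variation_le Cx' Cx.
Qed.

Lemma risk_optimal_piecewise_le s : optimal_piecewise mu Pk Xs C s ->
  (risk mu Pk Xs s - opt_risk mu Pk Xs <= D%:E)%E.
Proof.
move=> [_ /(_ _ median_rule_piecewise_const) smin].
rewrite leeBlDl ?opt_risk_fin_num// -leeBlDr//.
apply: le_ereal_inf_tmp => _ [s' ms' <-]; rewrite leeBlDr//.
exact: le_trans smin (risk_median_rule_le ms').
Qed.
End Variation.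

(** * From the Lipschitz condition to bounds by the mesh *)

Section Lipschitz.
Context (N : d.-tuple R -> R) (M : R).
Hypothesis N_ge0 : forall x, 0 <= N x.
Hypothesis lipPk : forall x x', Xs x -> Xs x' ->
  \sum_(i < n) \sum_(j < n | (i < j)%N) `|pairp (Pk x) i j - pairp (Pk x') i j|
    <= M * N (vsub x x').

Lemma variation_le_mesh i x x' : C i x -> C i x' ->
  ((\sum_(a < n) \sum_(b < n | (a < b)%N)
      `|pairp (Pk x) a b - pairp (Pk x') a b|)%:E <= M%:E * mesh N C)%E.
Proof.
move=> Cx Cx'; have Xx := cell_subset Cx; have Xx' := cell_subset Cx'.
apply: (@le_trans _ _ (M * N (vsub x x'))%:E); first by rewrite lee_fin lipPk.
have [M0|M0] := leP 0 M.
  rewrite EFinM lee_wpmul2l ?lee_fin//.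
  apply: le_trans (le_bigmax _ (fun i => diam N (C i)) i).
  by apply: ereal_sup_ubound; exists x => //; exists x'.
(* A negative Lipschitz constant forces the diameter of Xs to vanish. *)
apply: (@le_trans _ _ 0%E).
  by rewrite lee_fin nmulr_rle0.
apply: mule_le0; first by rewrite lee_fin ltW.
apply/bigmax_leP; split => [|j _]; first exact: leNye.
apply: ge_ereal_sup => _ [y Cy [y' Cy' <-]]; rewrite lee_fin.
rewrite -(nmulr_rge0 _ M0).
apply: le_trans (lipPk (cell_subset Cy) (cell_subset Cy')).
by apply: sumr_ge0 => a _; exact: sumr_ge0.
Qed.

(** The product dominates the variation from a point of a cell to itself, hence is nonnegative. An
    infinite mesh with [M = 0] falls in the finite case, since the product is then 0. *)
Lemma mulr_mesh_cases :
  (M%:E * mesh N C = +oo)%E \/ exists2 D, 0 <= D & (M%:E * mesh N C = D%:E)%E.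
Proof.
apply/gee0P; have [x /cell_exists[i Cx]] := partition_nonempty.
apply: le_trans (variation_le_mesh Cx Cx); rewrite lee_fin.
by apply: sumr_ge0 => a _; exact: sumr_ge0.
Qed.

Lemma excess_risk_le_mesh s : optimal_piecewise mu Pk Xs C s ->
  (risk mu Pk Xs s - opt_risk mu Pk Xs <= M%:E * mesh N C)%E.
Proof.
move=> sopt; case: mulr_mesh_cases => [->|[D D0 DE]]; first exact: leey.
rewrite DE; apply: risk_optimal_piecewise_le => // i x x' Cx Cx'.
by rewrite -lee_fin -DE; exact: variation_le_mesh Cx Cx'.
Qed.

Lemma margin_le x (i j : 'I_n) : Xs x -> (i < j)%N ->
  (margin Pk Xs <= `|pairp (Pk x) i j - 1/2|%:E)%E.
Proof.
move=> Xx ij; apply: le_trans (ereal_inf_lbound _) _; first by exists x.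
apply: (@bigmin_inf _ (\bar R) _ _ i) => //.
exact: (@bigmin_inf _ (\bar R) _ _ j).
Qed.

Lemma kendall_median_le_mesh i x : C i x ->
  strictly_transitive (Pk x) -> strictly_transitive (cond_distr mu Pk (C i)) ->
  (0 < margin Pk Xs)%E ->
  ((kendall (kemeny_median (Pk x))
            (kemeny_median (cond_distr mu Pk (C i))))%:R%:E
     <= (M%:E / margin Pk Xs) * mesh N C)%E.
Proof.
move=> Cx TP TC; have := margin_le (cell_subset Cx).
case: (margin Pk Xs) => [h||]// hP; rewrite ?lte_fin => h0.
  (* Regrouping isolates [M%:E * mesh N C], which is either infinite or a usable bound [D]. *)
  rewrite inver gt_eqF// muleAC.
  case: mulr_mesh_cases => [->|[D D0 DE]].
    by rewrite gt0_mulye ?leey// lte_fin invr_gt0.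
  rewrite DE -EFinM lee_fin ler_pdivlMr// mulrC.
  apply: le_trans (kendall_median_le TP TC _) _.
    by move=> a b ab; rewrite -lee_fin; exact: hP.
  apply: (@variation_cond_distr_le D) Cx => // j y y' Cy Cy'.
  by rewrite -lee_fin -DE; exact: variation_le_mesh Cy Cy'.
(* An infinite margin means that there is no pair [a < b]; its inverse is 0, and both sides
   vanish. *)
rewrite invey mule0 mul0e kendallE big1// => a _; rewrite big1// => b ab.
by have := hP _ _ ab.
Qed.
End Lipschitz.
End Partition.
End Regression.

Theorem theorem9 (R : realType) (d n : nat) (N : d.-tuple R -> R)
  (mu : probability (d.-tuple R) R) (Pk : d.-tuple R -> {ffun {perm 'I_n} -> R})
  (Xs : set (d.-tuple R)) (M : R) :
  (0 < d)%N ->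
  is_norm N ->
  measurable Xs ->
  mu Xs = 1%E ->
  (forall t : {perm 'I_n}, measurable_fun Xs (fun x => Pk x t)) ->
  (forall x, Xs x -> strictly_transitive (Pk x)) ->
  (forall x x', Xs x -> Xs x' ->
     \sum_(i < n) \sum_(j < n | (i < j)%N) `|pairp (Pk x) i j - pairp (Pk x') i j|
       <= M * N (vsub x x')) ->
  (* (1) *)
  (forall (k : nat) (C : 'I_k -> set (d.-tuple R)) (s : d.-tuple R -> {perm 'I_n}),
     is_partition mu Xs C -> optimal_piecewise mu Pk Xs C s ->
     (risk mu Pk Xs s - opt_risk mu Pk Xs <= M%:E * mesh N C)%E)
  /\
  (forall (km : nat -> nat) (Cm : forall m, 'I_(km m) -> set (d.-tuple R))
          (sm : nat -> d.-tuple R -> {perm 'I_n}),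
     (forall m, is_partition mu Xs (Cm m)) ->
     (forall m, optimal_piecewise mu Pk Xs (Cm m) (sm m)) ->
     mesh N (Cm m) @[m --> \oo] --> 0%E ->
     risk mu Pk Xs (sm m) @[m --> \oo] --> opt_risk mu Pk Xs)
  /\
  (* (2) *)
  (forall (k : nat) (C : 'I_k -> set (d.-tuple R)) (sstar : d.-tuple R -> {perm 'I_n}),
     is_partition mu Xs C ->
     (0 < margin Pk Xs)%E ->
     (forall i, strictly_transitive (cond_distr mu Pk (C i))) ->
     (forall i x, C i x -> sstar x = kemeny_median (cond_distr mu Pk (C i))) ->
     (\int[mu]_(x in Xs) ((kendall (kemeny_median (Pk x)) (sstar x))%:R)%:E
        <= ereal_sup [set ((kendall (kemeny_median (Pk x)) (sstar x))%:R)%:E | x in Xs])%E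
     /\
     (ereal_sup [set ((kendall (kemeny_median (Pk x)) (sstar x))%:R)%:E | x in Xs]
        <= (M%:E / margin Pk Xs) * mesh N C)%E).
Proof.
move=> _ [N_ge0 _ _ _] mXs muXs mPk TPk lipPk.
have dPk x : Xs x -> is_distr (Pk x) by move=> /TPk[].
have excess k (C : 'I_k -> set (d.-tuple R)) s :
    is_partition mu Xs C -> optimal_piecewise mu Pk Xs C s ->
    (risk mu Pk Xs s - opt_risk mu Pk Xs <= M%:E * mesh N C)%E.
  by move=> partC; exact: excess_risk_le_mesh.
have opt_fin := opt_risk_fin_num mXs muXs mPk dPk.
split=> //; split=> [km Cm sm partC sopt mesh0|k C sstar partC margin0 TC sstarE].
  (* The lower bound holds because piecewise constant rules are measurable and so compete in the
     infimum; the upper one is the excess bound. *)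
  apply: (@squeeze_cvge _ _ _ _ (fun=> opt_risk mu Pk Xs) _
    (fun m => M%:E * mesh N (Cm m) + opt_risk mu Pk Xs)%E).
  - apply: nearW => m; apply/andP; split; last by rewrite -leeBlDr// excess.
    apply: ereal_inf_lbound; exists (sm m) => //.
    exact (piecewise_const_measurable (partC m) (proj1 (sopt m))).
  - exact: cvg_cst.
  - rewrite -[X in _ --> X]add0e -(mule0 M%:E); apply: cvgeD.
    + by rewrite mule0 fin_num_adde_defl.
    + exact: cvgeZl.
    + exact: cvg_cst.
split.
  (* Mass 1 turns the supremum into the integral of a constant. *)
  rewrite -[leRHS]mule1 -muXs -(integral_cst mu mXs).
  apply: ge0_le_integral_nonmeasurable => x Xx; first by rewrite lee_fin.
  by apply: ereal_sup_ubound; exists x.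
apply: ge_ereal_sup => _ [x Xx <-].
have [i Cx] := cell_exists partC Xx; rewrite (sstarE i x Cx).
by apply: kendall_median_le_mesh => //; exact: TPk.
Qed.
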